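(* In the logic $\Sigma_{HK}$, the knowledge operator $K$ is not reducible to the operators $(L_r)_{r\in[0,1]\cap\mathbb{Q}}$; therefore $K$ is not explicitly defined in $\Sigma_{HK}$.
   Context: For a family of unary operators $(O_i)$, $\mathcal{L}((O_i))$ is the set of formulas built from countably many propositional letters by $\neg$, $\wedge$ and the operators $O_i$. A logic in such a language is a set of formulas containing all propositional tautologies and closed under modus ponens, uniform substitution, and replacement of provable equivalents (from $\phi\leftrightarrow\psi$ infer $O\phi\leftrightarrow O\psi$ for each operator $O$ of the language). $\Lambda+\phi$ is the smallest logic (in the language containing all operators involved) that contains $\Lambda\cup\{\phi\}$. Let $\mathcal{L}_0=\mathcal{L}((L_r)_{r\in[0,1]\cap\mathbb{Q}})$ and let $\mathcal{L}_{HK}$ be the language with operators $L_r$ ($r\in[0,1]\cap\mathbb{Q}$) and $K$. A definition of $K$ in terms of $(L_r)$ is a formula $DK: Kp\leftrightarrow\delta$ with $\delta\in\mathcal{L}_0$ and $p$ a propositional letter. For a logic $\Lambda$ in $\mathcal{L}_{HK}$ put $\Lambda_0=\Lambda\cap\mathcal{L}_0$. $K$ is explicitly defined in $\Lambda$ if some definition $DK$ belongs to $\Lambda$. $K$ is reducible to $(L_r)$ in $\Lambda$ if there is a definition $DK$ of $K$ in terms of $(L_r)$ such that $\Lambda_0+DK$ is a conservative extension of $\Lambda_0$ (i.e. $(\Lambda_0+DK)\cap\mathcal{L}_0=\Lambda_0$) and $\Lambda\subseteq\Lambda_0+DK$. $\Sigma_{HK}$ is the smallest logic in $\mathcal{L}_{HK}$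 containing: the probability axioms (A1) $L_0\phi$; (A2) $L_r\top$; (A3) $L_r(\phi\wedge\psi)\wedge L_t(\phi\wedge\neg\psi)\to L_{r+t}\phi$ for $r+t\le 1$; (A4) $\neg L_r(\phi\wedge\psi)\wedge\neg L_s(\phi\wedge\neg\psi)\to\neg L_{r+s}\phi$ for $r+s\le1$; (A5) $L_r\phi\to\neg L_s\neg\phi$ for $r+s>1$; $(4_p)$ $L_r\phi\to L_1L_r\phi$; $(5_p)$ $\neg L_r\phi\to L_1\neg L_r\phi$; the $S_5$ axioms $K(\phi\to\psi)\to(K\phi\to K\psi)$, $K\phi\to\phi$, $K\phi\to KK\phi$, $\neg K\phi\to K\neg K\phi$; the connecting axioms $(H1)$ $L_r\phi\to KL_r\phi$, $(H2)$ $\neg L_r\phi\to K\neg L_r\phi$, $(H3)$ $K\phi\to L_1\phi$; and closed under (DIS): from $\phi\leftrightarrow\psi$ infer $L_r\phi\leftrightarrow L_r\psi$; (ARCH): if $\gamma\to L_s\phi$ is a theorem for all $s<r$, then $\gamma\to L_r\phi$ is a theorem; and generalization for $K$: from $\phi$ infer $K\phi$. *)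

(* Defs.v *)
From mathcomp Require Import all_boot all_order all_algebra.

Set Implicit Arguments.
Unset Strict Implicit.
Unset Printing Implicit Defensive.

Import Order.TTheory GRing.Theory Num.Theory.
Local Open Scope ring_scope.

Inductive formula (I : Type) : Type :=
| Var (n : nat)
| Neg (a : formula I)
| And (a b : formula I)
| Op (i : I) (a : formula I).

Arguments Var {I} n.

Declare Scope form_scope.
Delimit Scope form_scope with F.
Bind Scope form_scope with formula.

Section Logics.
Variable I : Type.
Implicit Types (a b : formula I) (Lam Gam : formula I -> Prop).

Definition Imp a b := Neg (And a (Neg b)).
Definition Iff a b := And (Imp a b) (Imp b a).
Definition Top : formula I := Neg (And (Var 0) (Neg (Var 0))).

(** Truth-functional value; letters and formulas [Op i a] are the atoms. *)
Fixpoint eval (v : formula I -> bool) a : bool :=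
  match a with
  | Neg b => ~~ eval v b
  | And b c => eval v b && eval v c
  | Var _ | Op _ _ => v a
  end.

Definition tautology a : Prop := forall v : formula I -> bool, eval v a.

Fixpoint subst (s : nat -> formula I) a : formula I :=
  match a with
  | Var n => s n
  | Neg b => Neg (subst s b)
  | And b c => And (subst s b) (subst s c)
  | Op i b => Op i (subst s b)
  end.

Record is_logic Lam : Prop := IsLogic {
  logic_taut : forall a, tautology a -> Lam a;
  logic_mp : forall a b, Lam (Imp a b) -> Lam a -> Lam b;
  logic_subst : forall s a, Lam a -> Lam (subst s a);
  logic_repl : forall i a b, Lam (Iff a b) -> Lam (Iff (Op i a) (Op i b))
}.

(** [Lam + a]: the intersection of all logics containing [Lam] and [a]. *)
Definition logic_add Lam a : formula I -> Prop := fun b =>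
  forall Gam, is_logic Gam -> (forall c, Lam c -> Gam c) -> Gam a -> Gam b.

End Logics.

Notation "¬ a" := (Neg a) (at level 75, right associativity) : form_scope.
Notation "a ∧ b" := (And a b) (at level 80, right associativity) : form_scope.
Notation "a → b" := (Imp a b) (at level 90, right associativity) : form_scope.
Notation "a ↔ b" := (Iff a b) (at level 95, no associativity) : form_scope.

Definition unitQ := {r : rat | 0 <= r <= 1}.
Definition unitQ0 : unitQ := exist _ 0 isT.
Definition unitQ1 : unitQ := exist _ 1 isT.

Inductive HKop : Type := opL (r : unitQ) | opK.

Definition formHK := formula HKop.

Definition L (r : unitQ) (a : formHK) : formHK := Op (opL r) a.
Definition K (a : formHK) : formHK := Op opK a.

(** The sublanguage [L_0] of [L_HK]: formulas without occurrences of [K]. *)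
Fixpoint inL0 (a : formHK) : Prop :=
  match a with
  | Var _ => True
  | Neg b => inL0 b
  | And b c => inL0 b /\ inL0 c
  | Op (opL _) b => inL0 b
  | Op opK _ => False
  end.

Definition restrict0 (Lam : formHK -> Prop) : formHK -> Prop :=
  fun a => Lam a /\ inL0 a.

(** [d] may contain letters other than [p]. *)
Definition is_definition (D : formHK) : Prop :=
  exists (p : nat) (d : formHK), inL0 d /\ D = (K (Var p) ↔ d)%F.

Definition explicitly_defined (Lam : formHK -> Prop) : Prop :=
  exists D, is_definition D /\ Lam D.

Definition conservative_over0 (Lam' Lam0 : formHK -> Prop) : Prop :=
  forall a, restrict0 Lam' a <-> Lam0 a.

Definition reducible (Lam : formHK -> Prop) : Prop :=
  exists D, [/\ is_definition D,
    conservative_over0 (logic_add (restrict0 Lam) D) (restrict0 Lam) &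
    forall a, Lam a -> logic_add (restrict0 Lam) D a].

(** The side condition [r + t <= 1] of [A3] and [A4] is carried by the
    existence of [u : unitQ] whose value is [r + t]. *)
Inductive HKaxiom : formHK -> Prop :=
| A1 a : HKaxiom (L unitQ0 a)
| A2 r : HKaxiom (L r (Top HKop))
| A3 (r t u : unitQ) a b : val u = val r + val t ->
    HKaxiom (L r (a ∧ b) ∧ L t (a ∧ ¬ b) → L u a)%F
| A4 (r s u : unitQ) a b : val u = val r + val s ->
    HKaxiom (¬ L r (a ∧ b) ∧ ¬ L s (a ∧ ¬ b) → ¬ L u a)%F
| A5 (r s : unitQ) a : 1 < val r + val s ->
    HKaxiom (L r a → ¬ L s (¬ a))%F
| Ax4p r a : HKaxiom (L r a → L unitQ1 (L r a))%F
| Ax5p r a : HKaxiom (¬ L r a → L unitQ1 (¬ L r a))%F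
| AxK a b : HKaxiom (K (a → b) → (K a → K b))%F
| AxT a : HKaxiom (K a → a)%F
| Ax4 a : HKaxiom (K a → K (K a))%F
| Ax5 a : HKaxiom (¬ K a → K (¬ K a))%F
| H1 r a : HKaxiom (L r a → K (L r a))%F
| H2 r a : HKaxiom (¬ L r a → K (¬ L r a))%F
| H3 a : HKaxiom (K a → L unitQ1 a)%F.

Record HKclosed (Gam : formHK -> Prop) : Prop := IsHKclosed {
  HK_logic : is_logic Gam;
  HK_axioms : forall a, HKaxiom a -> Gam a;
  HK_DIS : forall r a b, Gam (a ↔ b)%F -> Gam (L r a ↔ L r b)%F;
  HK_ARCH : forall (r : unitQ) g a,
    (forall s : unitQ, val s < val r -> Gam (g → L s a)%F) ->
    Gam (g → L r a)%F;
  HK_gen : forall a, Gam a -> Gam (K a)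
}.

Definition SigmaHK : formHK -> Prop :=
  fun a => forall Gam, HKclosed Gam -> Gam a.

Lemma SigmaHK_closed : HKclosed SigmaHK.
Proof.
split.
- split.
  + move=> a ta G CG; exact: logic_taut (HK_logic CG) _ ta.
  + move=> a b Hab Ha G CG; have [[_ mp _ _] _ _ _ _] := CG.
    exact: mp (Hab G CG) (Ha G CG).
  + move=> s a Ha G CG; have [[_ _ us _] _ _ _ _] := CG; exact: us (Ha G CG).
  + move=> i a b Hab G CG; have [[_ _ _ re] _ _ _ _] := CG.
    exact: re (Hab G CG).
- by move=> a Ha G CG; apply: (HK_axioms CG).
- by move=> r a b Hab G CG; apply: (HK_DIS CG); apply: Hab.
- by move=> r g a H G CG; apply: (HK_ARCH CG) => s sr; apply: H.
- by move=> a Ha G CG; apply: (HK_gen CG); apply: Ha.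
Qed.

(* Main.v *)
Require Import Defs.
From mathcomp Require Import all_boot all_order all_algebra.
From mathcomp Require Import lra.

(** Why [K] cannot be defined from the [L_r].

    Consider two states, [true] and [false], the point mass at [true] as the
    probability at both of them, and a single information cell containing both.
    This is a model of [SigmaHK] ([valid_HKclosed]).  Its probability measure
    does not see [false], so the truth of a formula of [L_0] at [true] depends
    only on the truth of the letters at [true] ([sem_true_inL0]).

    Let [Gam] be a logic containing [SigmaHK] and a definition
    [K p <-> delta], and proving no [K]-free formula beyond those of [SigmaHK].
    Trading [K] for [delta] in theorems of [Gam] yields [K]-free theorems, so
    that the operator [G] which [delta] denotes on the events of the model
    satisfies the laws of knowledge that [SigmaHK] imposes.  Now [G] maps the
    whole space to itself, so [true] lies in [G {true}] because membership of
    [true] is determined by what happens at [true]; with veracity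
    [G {true} = {true}].  Negative introspection then requires [false] to lie in
    [G {false}], whereas [{false}] has probability [0] and what is known must
    have probability [1].  Hence no such [Gam] exists ([no_definition]).

    Non-reducibility is the case where [Gam] is the conservative extension
    obtained by adding the definition; non-definability is the case where [Gam]
    is [SigmaHK] itself. *)

Set Implicit Arguments.
Unset Strict Implicit.
Unset Printing Implicit Defensive.

Import Order.TTheory GRing.Theory Num.Theory.
Local Open Scope ring_scope.

Ltac truth_table :=
  let v := fresh in
  move=> v /=;
  repeat match goal with
  | |- context [eval v ?a] => case: (eval v a)
  | |- context [v ?a] => case: (v a)
  end.

Lemma logic_mp2 (I : Type) (Lam : formula I -> Prop) a b c :
  is_logic Lam -> tautology (Imp a (Imp b c)) -> Lam a -> Lam b -> Lam c.
Proof.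
move=> LL t la lb; apply: (logic_mp LL) lb.
by apply: (logic_mp LL) la; apply: (logic_taut LL).
Qed.

Lemma logic_add_is_logic (I : Type) (Lam : formula I -> Prop) a :
  is_logic (logic_add Lam a).
Proof.
split.
- by move=> b tb Gam LG _ _; apply: (logic_taut LG).
- move=> b c Hbc Hb Gam LG sG Ga.
  exact: (logic_mp LG (Hbc Gam LG sG Ga) (Hb Gam LG sG Ga)).
- by move=> s b Hb Gam LG sG Ga; apply: (logic_subst LG); apply: Hb.
- by move=> i b c Hbc Gam LG sG Ga; apply: (logic_repl LG); apply: Hbc.
Qed.

Lemma inL0_subst s a :
  inL0 a -> (forall n, inL0 (s n)) -> inL0 (subst s a).
Proof.
move=> + Hs; elim: a => [n|a IH|a IHa b IHb|[r|] a IH] //=.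
by case=> /IHa ? /IHb.
Qed.

(** An event of the two-state model is a map [bool -> bool].  Under the point
    mass at [true], an event has probability at least [r] exactly when [r = 0]
    or the event contains [true]. *)
Fixpoint sem (V : nat -> bool -> bool) (a : formHK) (w : bool) : bool :=
  match a with
  | Var n => V n w
  | Neg b => ~~ sem V b w
  | And b c => sem V b w && sem V c w
  | Op (opL r) b => (val r == 0) || sem V b true
  | Op opK b => sem V b true && sem V b false
  end.

Definition valid (a : formHK) : Prop := forall V w, sem V a w.

Lemma sem_subst s a V w :
  sem V (subst s a) w = sem (fun n => sem V (s n)) a w.
Proof.
elim: a w => [n|a IH|a IHa b IHb|[r|] a IH] w //=; rewrite ?IH //.
by rewrite IHa IHb.
Qed.

Lemma eval_sem V w a : eval (fun c => sem V c w) a = sem V a w.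
Proof. by elim: a => [n|a /= ->|a /= -> b /= ->|i a] //. Qed.

Lemma sem_Imp V w a b : sem V (Imp a b) w = (sem V a w ==> sem V b w).
Proof. by rewrite /= negb_and negbK implybE. Qed.

Lemma sem_Iff V w a b : sem V (Iff a b) w = (sem V a w == sem V b w).
Proof. by rewrite /=; case: (sem V a w); case: (sem V b w). Qed.

Lemma valid_repl i a b : valid (Iff a b) -> valid (Iff (Op i a) (Op i b)).
Proof.
move=> H V w.
have E x : sem V a x = sem V b x by apply/eqP; rewrite -sem_Iff.
by rewrite sem_Iff; case: i => [r|] /=; rewrite !E.
Qed.

Lemma valid_is_logic : is_logic valid.
Proof.
split.
- by move=> a ta V w; rewrite -eval_sem.
- by move=> a b Hab Ha V w; have := Hab V w; rewrite sem_Imp Ha.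
- by move=> s a Ha V w; rewrite sem_subst.
- exact: valid_repl.
Qed.

(** The threshold [0] is the only one that the measure does not settle by
    looking at [true], so A3 and A4 turn on when the sum of two thresholds
    vanishes, and A5 on both thresholds being nonzero if their sum exceeds 1. *)
Lemma valid_axioms a : HKaxiom a -> valid a.
Proof.
have nn (r : unitQ) : 0 <= sval r <= 1 by case: r.
case=> {a}.
- by move=> a V w.
- by move=> r V w /=; rewrite andbN orbT.
- move=> r t u a b /= E V w /=; rewrite E.
  have [/andP[r0 _] /andP[t0 _]] := (nn r, nn t).
  rewrite paddr_eq0 //; case: (_ == 0); case: (_ == 0);
    by case: (sem V a true); case: (sem V b true).
- move=> r t u a b /= E V w /=; rewrite E.
  have [/andP[r0 _] /andP[t0 _]] := (nn r, nn t).
  rewrite paddr_eq0 //; case: (_ == 0); case: (_ == 0);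
    by case: (sem V a true); case: (sem V b true).
- move=> r s a /= lt1 V w /=.
  have [/andP[r0 r1] /andP[s0 s1]] := (nn r, nn s).
  have -> : (sval r == 0) = false by apply/eqP => E; move: r1 s1 lt1; lra.
  have -> : (sval s == 0) = false by apply/eqP => E; move: r1 s1 lt1; lra.
  by case: (sem V a true).
all: try by move=> ? V w /=; case: w; case: (sem V _ true);
  case: (sem V _ false).
all: try by move=> r a V w /=; case: (_ == 0); case: (sem V a true).
by move=> a b V w /=; case: (sem V a true); case: (sem V b true);
  case: (sem V a false); case: (sem V b false).
Qed.

Lemma valid_HKclosed : HKclosed valid.
Proof.
split.
- exact: valid_is_logic.
- exact: valid_axioms.
- by move=> r a b; apply: valid_repl.
- move=> r g a H V w; rewrite sem_Imp; apply/implyP => gw /=.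
  case: eqP => //= /eqP r_neq0.
  have /andP[r0 r1] : 0 <= val r <= 1 by case: r {H r_neq0}.
  have {r_neq0}r0 : 0 < val r by rewrite lt_def r_neq0.
  (* any threshold strictly between [0] and [r] forces [a] at [true] *)
  have half01 : 0 <= val r / 2 <= 1 by lra.
  pose h : unitQ := exist _ (val r / 2) half01.
  have lthr : val h < val r by rewrite /=; move: r0 => /=; lra.
  have := H h lthr V w; rewrite sem_Imp gw /=.
  have -> // : (sval r / 2 == 0) = false.
  by apply/eqP; move: r0 => /=; lra.
- by move=> a Ha V w /=; rewrite !Ha.
Qed.

Lemma SigmaHK_valid a : SigmaHK a -> valid a.
Proof. by apply; exact: valid_HKclosed. Qed.

Lemma sem_true_inL0 a V V' : inL0 a ->
  (forall n, V n true = V' n true) -> sem V a true = sem V' a true.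
Proof.
move=> + E; elim: a => [n|a IH|a IHa b IHb|[r|] a IH] //=.
- by move/IH->.
- by case=> /IHa-> /IHb->.
- by move/IH->.
Qed.

(** A definition may mention letters other than [p]; they are fixed to truth so
    that what remains is a one-place operator. *)
Definition instance (p : nat) (d a : formHK) : formHK :=
  subst (fun n => if n == p then a else Top HKop) d.

Definition event_op (p : nat) (d : formHK) (X : bool -> bool) : bool -> bool :=
  sem (fun n => if n == p then X else fun=> true) d.

Lemma sem_ext V V' a w : (forall n x, V n x = V' n x) -> sem V a w = sem V' a w.
Proof.
move=> E; elim: a w => [n|a IH|a IHa b IHb|[r|] a IH] w //=; rewrite ?IH //.
by rewrite IHa IHb.
Qed.

Lemma event_op_ext p d X Y w : X =1 Y -> event_op p d X w = event_op p d Y w.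
Proof. by move=> E; apply: sem_ext => n x; case: ifP. Qed.

Lemma sem_instance p d a V w :
  sem V (instance p d a) w = event_op p d (sem V a) w.
Proof.
rewrite sem_subst; apply: sem_ext => n x.
by case: ifP => //= _; rewrite andbN.
Qed.

Lemma inL0_instance p d a : inL0 d -> inL0 a -> inL0 (instance p d a).
Proof. by move=> d0 a0; apply: inL0_subst => // n; case: ifP. Qed.

(** The hypothesis on [K]-free theorems is what makes a contradiction possible:
    it is the only link from [Gam], in which the definition may hold for a
    reason foreign to the model, back to validity in the model. *)
Lemma no_definition (Gam : formHK -> Prop) D :
  is_logic Gam -> (forall a, SigmaHK a -> Gam a) ->
  (forall a, Gam a -> inL0 a -> SigmaHK a) ->
  is_definition D -> ~ Gam D.
Proof.
move=> LG sSG cons [p [d [d0 ->]]] GD.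
have Kinst a : Gam (Iff (K a) (instance p d a)).
  have := logic_subst LG (fun n => if n == p then a else Top HKop) GD.
  by rewrite /= eqxx.
have ax a : HKaxiom a -> Gam a.
  by move=> Ha; apply: sSG; apply: (HK_axioms SigmaHK_closed).
have vGam a : Gam a -> inL0 a -> valid a.
  by move=> Ga a0; exact: (SigmaHK_valid (cons a Ga a0)).
pose P : formHK := Var p; pose dP := instance p d P.
have dP0 : inL0 dP by exact: inL0_instance.
(* the laws of knowledge for the defining formula, first without [K] in [Gam],
   then in the model *)
have vT : valid (Imp dP P).
  apply: vGam; last by split.
  apply: (logic_mp2 LG) (Kinst P) (ax _ (AxT P)).
  by truth_table.
have vH3 : valid (Imp dP (L unitQ1 P)).
  apply: vGam; last by split.
  apply: (logic_mp2 LG) (Kinst P) (ax _ (H3 P)).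
  by truth_table.
have vTop : valid (instance p d (Top HKop)).
  have KT : Gam (K (Top HKop)).
    apply: sSG; apply: (HK_gen SigmaHK_closed).
    by apply: (logic_taut (HK_logic SigmaHK_closed)); truth_table.
  apply: vGam; last exact: inL0_instance.
  by apply: (logic_mp2 LG) (Kinst (Top HKop)) KT; truth_table.
have v5 : valid (Imp (Neg dP) (instance p d (Neg dP))).
  have K5 : Gam (Imp (Neg dP) (K (Neg (K P)))).
    apply: (logic_mp2 LG) (Kinst P) (ax _ (Ax5 P)).
    by truth_table.
  have KE : Gam (Iff (K (Neg (K P))) (K (Neg dP))).
    apply: (logic_repl LG); apply: (logic_mp LG) (Kinst P).
    by apply: (logic_taut LG); truth_table.
  have K5' : Gam (Imp (Neg dP) (K (Neg dP))).
    by apply: (logic_mp2 LG) K5 KE; truth_table.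
  apply: vGam; last by split=> //; apply: inL0_instance.
  by apply: (logic_mp2 LG) K5' (Kinst (Neg dP)); truth_table.
pose G := event_op p d.
have GT X w : G X w -> X w.
  by have := vT (fun=> X) w; rewrite sem_Imp sem_instance => /implyP.
have GH3 X w : G X w -> X true.
  by have := vH3 (fun=> X) w; rewrite sem_Imp sem_instance => /implyP.
have G5 X w : ~~ G X w -> G (fun x => ~~ G X x) w.
  have := v5 (fun=> X) w; rewrite sem_Imp sem_instance => /implyP /=.
  move=> H nG; rewrite /G -(@event_op_ext p d (sem (fun=> X) (Neg dP))).
    by apply: H; rewrite sem_instance.
  by move=> x /=; rewrite sem_instance.
(* [id] is the event {true}, which agrees at [true] with the whole space *)
have G1 : G id true.
  have -> : G id true = G (sem (fun=> id) (Top HKop)) true.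
    by apply: sem_true_inL0 => // n; case: ifP.
  by rewrite /G -sem_instance.
have G0 : ~~ G id false by apply/negP => /GT.
(* negative introspection at [false] makes the complement of [G id] known there,
   yet [true], which carries all the probability, is outside that complement *)
by have /GH3 := G5 id false G0; rewrite G1.
Qed.

Theorem theorem4p12 : ~ reducible SigmaHK /\ ~ explicitly_defined SigmaHK.
Proof.
split=> [[D [defD cons sub]] | [D [defD SD]]].
- apply: (no_definition (logic_add_is_logic (restrict0 SigmaHK) D)) defD _.
  + exact: sub.
  + by move=> a Ha a0; have [] := (cons a).1 (conj Ha a0).
  + by move=> Gam _ _.
- exact: (no_definition (HK_logic SigmaHK_closed)) defD SD.
Qed.
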